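(* Let $\mathcal{H}$ be a complex Hilbert space, let $Q\subset\mathbb{C}^n$ be a complete circular domain centered at $0\in Q$, and let $f:Q\to\mathcal{B}(\mathcal{H})$ be given by a series of homogeneous polynomials $f(z)=\sum_{k=0}^{\infty}P_k(z)$ such that this series and the series $\sum_{k=1}^{\infty}k\|P_k(z)\|^2$ converge in $Q$, $\|f(z)\|<1$ for all $z\in Q$, and $f(0)=a_0I$ with $a_0\in\mathbb{C}$, $|a_0|<1$. Let $G(w)=c_1w+c_2w^2+\cdots+c_lw^l$ be a polynomial with $c_i\in\mathbb{R}^{+}$, $i=1,\dots,l$, whose coefficients satisfy $$8c_1\left(\frac{3}{8}\right)^2+24c_2\left(\frac{3}{8}\right)^4+\cdots+8(2l-1)c_l\left(\frac{3}{8}\right)^{2l}\le 1 .$$ Then $$\sum_{k=0}^{\infty}\|P_k(z)\|+G\left(\sum_{k=1}^{\infty}k\|P_k(z)\|^2\right)\le 1$$ for all $z$ in the homothetic domain $(1/3)Q$. Moreover, if $Q$ is convex, then $1/3$ cannot be replaced by a larger quantity, i.e. for every $\rho\in(1/3,1)$ there is a function $f:Q\to\mathcal{B}(\mathcal{H})$, given by a series of homogeneous polynomials $f(z)=\sum_{k=0}^{\infty}P_k(z)$ such that this series and the series $\sum_{k=1}^{\infty}k\|P_k(z)\|^2$ converge in $Q$, with $\|f(z)\|<1$ for all $z\in Q$ and $f(0)=a_0I$ for some $a_0\in\mathbb{C}$, $|a_0|<1$, for which the inequality fails at some point of $\rho Q$.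
   Context: $\mathcal{B}(\mathcal{H})$ is the algebra of all bounded linear operators on $\mathcal{H}$ with the operator norm $\|\cdot\|$, and $I$ is the identity operator. A domain $Q\subset\mathbb{C}^n$ is a complete circular domain centered at $0\in Q$ if for each $z=(z_1,\dots,z_n)\in Q$ and each $\xi\in\mathbb{C}$ with $|\xi|\le 1$ one has $(\xi z_1,\dots,\xi z_n)\in Q$. Every analytic function $f:Q\to\mathcal{B}(\mathcal{H})$ has an expansion $f(z)=\sum_{k=0}^\infty P_k(z)$, where $P_k(z)=\sum_{|\alpha|=k}A_\alpha z^\alpha$, $A_\alpha\in\mathcal{B}(\mathcal{H})$ (standard multi-index notation), is a homogeneous polynomial of degree $k$ and $P_0(z)=f(0)$. For $\rho>0$, $\rho Q=\{\rho z: z\in Q\}$. The general term of the condition on $G$ is $8(2m-1)c_m(3/8)^{2m}$, $m=1,\dots,l$.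
   Formalization: In the sharpness part, Q ≠ C^n and H ≠ {0} are assumed: for Q = C^n Liouville's theorem forces f to be constant, and for H = {0} all norms vanish, so the inequality could never fail. *)

(* Defs.v *)
From HB Require Import structures.
From mathcomp Require Import all_boot all_order all_algebra.
From mathcomp Require Import all_classical all_reals all_analysis.
From mathcomp Require Import complex.

Set Implicit Arguments.
Unset Strict Implicit.
Unset Printing Implicit Defensive.

Import Order.TTheory GRing.Theory Num.Theory.
Import numFieldNormedType.Exports.

Local Open Scope classical_set_scope.
Local Open Scope ring_scope.

(* [R[i]] packed as a [numClosedFieldType], so that the topological and normed
   structures of number fields are inferred on it.  Its order is the partial
   order of the complex numbers: [`|x| < 1] compares two real complex numbers. *)
Definition cplx (R : realType) : numClosedFieldType := R[i].

Definition of_real (R : realType) (x : R) : cplx R := (x%:C)%C.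

Section real_norm.
Variables (R : realType) (V : normedModType (cplx R)).

Definition rnorm (x : V) : R := complex.Re (`|x| : R[i]).

Lemma rnormE (x : V) : `|x| = of_real (rnorm x).
Proof.
have : 0 <= (`|x| : R[i]) by exact: normr_ge0.
rewrite /rnorm /of_real; case: (`|x|) => a b /=.
by rewrite lecE /= => /andP[/eqP -> _].
Qed.

Lemma rnorm_ge0 (x : V) : 0 <= rnorm x.
Proof. by have := normr_ge0 x; rewrite rnormE /of_real ler0c. Qed.

Lemma rnorm0 : rnorm 0 = 0. Proof. by rewrite /rnorm normr0. Qed.

Lemma rnorm_eq0 (x : V) : rnorm x = 0 -> x = 0.
Proof. by move=> x0; apply/normr0_eq0; rewrite rnormE x0. Qed.

Lemma ler_rnormD (x y : V) : rnorm (x + y) <= rnorm x + rnorm y.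
Proof.
have := ler_normD x y; rewrite !rnormE /of_real.
by rewrite -(rmorphD (real_complex R)) lecR.
Qed.

Lemma rnormZ (a : cplx R) (x : V) :
  rnorm (a *: x) = complex.Re (`|a| : R[i]) * rnorm x.
Proof.
rewrite {1}/rnorm normrZ rnormE /of_real.
by case: (`|a|) => u v /=; rewrite mulr0 subr0.
Qed.

End real_norm.

Section bounded_operators.
Variables (R : realType) (H : normedModType (cplx R)).

Definition bounded_operator : {pred H -> H} := fun T =>
  `[< linear T /\ exists M : R, forall x, rnorm (T x) <= M * rnorm x >].

Lemma bounded_operatorP (T : H -> H) : reflect
  (linear T /\ exists M : R, forall x, rnorm (T x) <= M * rnorm x)
  (T \in bounded_operator).
Proof. exact: asboolP. Qed.

Lemma bounded_operator_submod_closed : submod_closed bounded_operator.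
Proof.
split.
  apply/bounded_operatorP; split; first by move=> a x y; rewrite /= scaler0 addr0.
  by exists 0 => x; rewrite rnorm0 mul0r.
move=> a S T /bounded_operatorP[lS [M hM]] /bounded_operatorP[lT [N hN]].
apply/bounded_operatorP; split.
  move=> b x y; rewrite !fctE lS lT !scalerDr !scalerA (mulrC a b).
  by rewrite addrACA.
exists (complex.Re (`|a| : R[i]) * M + N) => x; rewrite !fctE.
rewrite (le_trans (ler_rnormD _ _)) // mulrDl lerD // rnormZ -mulrA.
by rewrite ler_wpM2l // (@rnorm_ge0 R (cplx R)^o a).
Qed.

Record bop := Bop { bopfun :> H -> H; bopP : bopfun \in bounded_operator }.

HB.instance Definition _ := [isSub for bopfun].
HB.instance Definition _ := [Choice of bop by <:].
HB.instance Definition _ := GRing.isSubmodClosed.Build _ _ bounded_operator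
  bounded_operator_submod_closed.
HB.instance Definition _ := [SubChoice_isSubLmodule of bop by <:].

Definition opnorm (T : bop) : R :=
  sup [set rnorm (T x) | x in [set x : H | rnorm x <= 1]].

Lemma bopD (S T : bop) x : (S + T) x = S x + T x. Proof. by []. Qed.

Lemma bopZ (a : cplx R) (T : bop) x : (a *: T) x = a *: T x. Proof. by []. Qed.

Lemma bop_linear (T : bop) : linear T.
Proof. by have /bounded_operatorP[] := bopP T. Qed.

Lemma opnorm_has_sup (T : bop) :
  has_sup [set rnorm (T x) | x in [set x : H | rnorm x <= 1]].
Proof.
have /bounded_operatorP[_ [M hM]] := bopP T; split.
  by exists (rnorm (T 0)), 0 => //=; rewrite rnorm0.
exists (Num.max M 0) => _ [x /= x1 <-]; rewrite (le_trans (hM x)) //.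
have [M0|M0] := leP 0 M; first by rewrite ler_piMr.
by rewrite mulr_le0_ge0 ?rnorm_ge0 // ltW.
Qed.

Lemma opnorm_ge0 (T : bop) : 0 <= opnorm T.
Proof.
rewrite (le_trans (rnorm_ge0 (T 0))) // ub_le_sup //.
  by case: (opnorm_has_sup T).
by exists 0 => //=; rewrite rnorm0.
Qed.

Lemma ler_opnorm (T : bop) (x : H) : rnorm (T x) <= opnorm T * rnorm x.
Proof.
have T0 : T 0 = 0.
  have := bop_linear T 1 0 0; rewrite !scale1r addr0 => /esym/eqP.
  by rewrite -subr_eq0 addrK => /eqP.
have [->|x0] := eqVneq x 0; first by rewrite T0 !rnorm0 mulr0.
have nx : 0 < rnorm x.
  by rewrite lt_neqAle rnorm_ge0 eq_sym andbT; apply: contra_neq x0 => /rnorm_eq0.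
pose a : cplx R := of_real (rnorm x)^-1.
have na : complex.Re (`|a| : R[i]) = (rnorm x)^-1.
  by rewrite /a /of_real ger0_norm // ler0c invr_ge0 ltW.
have := bop_linear T a x 0; rewrite T0 !addr0 => Tax.
rewrite -ler_pdivrMr // mulrC -na -rnormZ -Tax; apply: ub_le_sup.
  by case: (opnorm_has_sup T).
by exists (a *: x) => //=; rewrite rnormZ na mulVf // gt_eqF.
Qed.

Lemma opnorm_le (T : bop) (M : R) :
  0 <= M -> (forall x, rnorm (T x) <= M * rnorm x) -> opnorm T <= M.
Proof.
move=> M0 hM; apply: ge_sup.
  by exists (rnorm (T 0)), 0 => //=; rewrite rnorm0.
by move=> _ [x /= x1 <-]; rewrite (le_trans (hM x)) // ler_piMr.
Qed.

Lemma ler_opnormD (S T : bop) :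
  of_real (opnorm (S + T)) <= of_real (opnorm S) + of_real (opnorm T).
Proof.
rewrite /of_real -(rmorphD (real_complex R)) lecR.
apply: opnorm_le => [|x]; first by rewrite addr_ge0 ?opnorm_ge0.
by rewrite (le_trans (ler_rnormD _ _)) // mulrDl lerD // ler_opnorm.
Qed.

Lemma opnorm_eq0 (T : bop) : of_real (opnorm T) = 0 -> T = 0.
Proof.
move=> [T0]; apply/val_inj/funext => x; apply/rnorm_eq0/le_anti.
by rewrite rnorm_ge0 andbT (le_trans (ler_opnorm T x)) // T0 mul0r.
Qed.

Lemma opnormZ (a : cplx R) (T : bop) :
  of_real (opnorm (a *: T)) = `|a| * of_real (opnorm T).
Proof.
have le_Z (b : cplx R) (S : bop) :
    opnorm (b *: S) <= complex.Re (`|b| : R[i]) * opnorm S.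
  apply: opnorm_le => [|x].
    by rewrite mulr_ge0 ?opnorm_ge0 // (@rnorm_ge0 R (cplx R)^o b).
  by rewrite rnormZ -mulrA ler_wpM2l ?ler_opnorm // (@rnorm_ge0 R (cplx R)^o b).
have na : `|a| = of_real (complex.Re (`|a| : R[i])) :=
  @rnormE R (cplx R)^o a.
rewrite na /of_real -(rmorphM (real_complex R)); congr (_%:C)%C.
apply/le_anti; rewrite le_Z andTb.
have [->|a0] := eqVneq a 0.
  by rewrite [complex.Re _](@rnorm0 R (cplx R)^o) mul0r opnorm_ge0.
have ra : 0 < complex.Re (`|a| : R[i]).
  rewrite lt_neqAle (@rnorm_ge0 R (cplx R)^o a) eq_sym andbT.
  by apply: contra_neq a0 => /(@rnorm_eq0 R (cplx R)^o a).
have := le_Z a^-1 (a *: T); rewrite scalerA mulVf // scale1r.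
rewrite normfV na /of_real -(fmorphV (real_complex R)) /=.
by rewrite ler_pdivlMl.
Qed.

HB.instance Definition _ := Lmodule_isNormed.Build (cplx R) bop
  ler_opnormD opnormZ opnorm_eq0.

Lemma bop_normE (T : bop) : `|T| = of_real (opnorm T).
Proof. by []. Qed.

Lemma id_bounded_operator : (idfun : H -> H) \in bounded_operator.
Proof.
by apply/bounded_operatorP; split => //; exists 1 => x; rewrite mul1r.
Qed.

Definition idop : bop := Bop id_bounded_operator.

End bounded_operators.

Section homogeneous_polynomials.
Variables (R : realType) (n : nat) (H : normedModType (cplx R)).
Implicit Types (P : nat -> 'rV[cplx R]_n -> bop H) (z : 'rV[cplx R]_n).

(* The multi-indices of weight [k] have entries at most [k]. *)
Definition homogeneous_poly (k : nat) (p : 'rV[cplx R]_n -> bop H) : Prop :=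
  exists A : {ffun 'I_n -> 'I_k.+1} -> bop H, forall z,
    p z = \sum_(alpha : {ffun 'I_n -> 'I_k.+1} | (\sum_i alpha i == k)%N)
            (\prod_i z 0 i ^+ alpha i) *: A alpha.

(* The partial sums of [\sum_(k >= 1) k * |P_k z| ^ 2]; the term of index [0]
   vanishes. *)
Definition area_series P z : R^nat :=
  series (fun k => k%:R * opnorm (P k z) ^+ 2).

Definition contractive_expansion (Q : set 'rV[cplx R]_n) P
    (f : 'rV[cplx R]_n -> bop H) (a0 : cplx R) : Prop :=
  [/\ forall k, homogeneous_poly k (P k),
      forall z, Q z -> series (P ^~ z) @ \oo --> f z,
      forall z, Q z -> cvgn (area_series P z),
      forall z, Q z -> `|f z| < 1
    & f 0 = a0 *: idop H /\ `|a0| < 1].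

(* The norm series is summed in [\bar R], where a divergent series of
   nonnegative terms has value [+oo]. *)
Definition bohr_sum (G : {poly R}) P z : \bar R :=
  (\sum_(0 <= k <oo) (opnorm (P k z))%:E + (G.[limn (area_series P z)])%:E)%E.

End homogeneous_polynomials.

Section domains.
Variables (R : realType) (n : nat).

Definition complete_circular_domain (Q : set 'rV[cplx R]_n) : Prop :=
  [/\ open Q, connected Q, Q 0
    & forall (z : 'rV[cplx R]_n) (xi : cplx R), Q z -> `|xi| <= 1 -> Q (xi *: z)].

Definition homothety (rho : R) (Q : set 'rV[cplx R]_n) : set 'rV[cplx R]_n :=
  [set of_real rho *: z | z in Q].

End domains.

(* Main.v *)
(* Fix [w] in [Q] and put [A k := P k w], so that [xi |-> f (xi w)] has Taylor
   coefficients [A k] and is bounded by [1] on the unit disc.  Parseval's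
   identity over roots of unity gives, for all vectors [x] and [y],
   [|A 0 x|^2 + |A k x + A 0 y|^2 <= |x|^2 + |y|^2]; since [A 0 = a0 I], a
   suitable [y] proportional to [A k x] yields the Schwarz-Pick bound
   [|A k| <= 1 - |a0|^2].  Summing the series at [w / 3] then reduces the
   inequality to a termwise comparison with the hypothesis on the [c m].
   For sharpness, Hahn-Banach separates [Q] from a point outside it by a
   complex linear form [Phi] with [|Phi| < 1] on [Q] and [|Phi| > 1 / 3] at
   some point of [rho Q]; there the Moebius function
   [(a - Phi) / (1 - a Phi) I] violates the inequality for [a] close to [1]. *)
Require Import Defs.
From HB Require Import structures.
From mathcomp Require Import all_boot all_order all_algebra.
From mathcomp Require Import all_classical all_reals all_analysis.
From mathcomp Require Import complex.
From mathcomp Require Import cyclic separable cyclotomic.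
From mathcomp Require Import ring lra zify.

Set Implicit Arguments.
Unset Strict Implicit.
Unset Printing Implicit Defensive.

Import Order.TTheory GRing.Theory Num.Theory.
Import numFieldNormedType.Exports.

Local Open Scope classical_set_scope.
Local Open Scope ring_scope.

(** * Roots of unity and the discrete Parseval identity *)

Lemma prim_root_exists (C : numClosedFieldType) (M : nat) :
  (0 < M)%N -> exists z : C, M.-primitive_root z.
Proof.
move=> M0.
have pM : 'X^M - 1 \is @monic C by rewrite monicXnsubC.
have [rs Drs] := closed_field_poly_normal ('X^M - 1 : {poly C}).
move: Drs; rewrite (monicP pM) scale1r => Drs.
have /hasP[z _ zM] : has M.-primitive_root rs.
  apply: has_prim_root => //.
  - apply/allP => z; rewrite -root_prod_XsubC -Drs unity_rootE.
    by rewrite /root !hornerE subr_eq0.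
  - rewrite -separable_prod_XsubC -Drs separable_Xn_sub_1 //.
    by rewrite pnatr_eq0 -lt0n.
  - by have := size_XnsubC (1 : C) M0; rewrite Drs size_prod_XsubC => -[->].
by exists z.
Qed.

(** Orthogonality of characters: the summands are the powers of [w = z ^+ j * conj (z ^+ k)], which
    satisfies [w ^+ M = 1]. For [j] and [k] distinct and below [M], [w] differs from 1 and the
    geometric sum vanishes. *)
Lemma sum_prim_root_conj (C : numClosedFieldType) (M : nat) (z : C)
    (j k : 'I_M) : M.-primitive_root z ->
  \sum_(i < M) (z ^+ i) ^+ j * Num.conj ((z ^+ i) ^+ k) = (M%:R *+ (j == k)).
Proof.
move=> zM.
have nz : `|z| = 1.
  apply/eqP; rewrite -(@pexpr_eq1 _ _ M) // ?(prim_order_gt0 zM) //.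
  by rewrite -normrX prim_expr_order // normr1.
have zK m : z ^+ m * Num.conj (z ^+ m) = 1 by rewrite -normCK normrX nz !expr1n.
pose w := z ^+ j * Num.conj (z ^+ k).
have wE i : (z ^+ i) ^+ j * Num.conj ((z ^+ i) ^+ k) = w ^+ i.
  by rewrite -!exprM !(mulnC i) !exprM exprMn rmorphXn.
under eq_bigr do rewrite wE.
have [jk|jk] := eqVneq j k.
  under eq_bigr do rewrite /w jk zK expr1n.
  by rewrite sumr_const card_ord.
have w1 : w - 1 != 0.
  rewrite subr_eq0; apply: contra jk => /eqP w1.
  have : z ^+ j == z ^+ k.
    by rewrite -[X in X == _]mulr1 -(zK k) mulrCA -/w w1 mulr1.
  by rewrite (eq_prim_root_expr zM) !modn_small.
apply: (mulfI w1); rewrite -subrX1 mulr0; apply/eqP; rewrite subr_eq0.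
by rewrite exprMn -rmorphXn -!exprM !(mulnC _ M) !exprM (prim_expr_order zM)
  !expr1n rmorph1 mulr1.
Qed.

Lemma parseval_roots_of_unity (C : numClosedFieldType) (U : lmodType C)
    (dot : {dot U for Num.conj}) (M : nat) (z : C) (B : nat -> U) :
  M.-primitive_root z ->
  \sum_(i < M) dot (\sum_(j < M) (z ^+ i) ^+ j *: B j)
                   (\sum_(j < M) (z ^+ i) ^+ j *: B j) =
  M%:R * \sum_(j < M) dot (B j) (B j).
Proof.
move=> zM.
under eq_bigr => i _.
  rewrite linear_sumlz.
  under eq_bigr => j _ do (rewrite linear_sumr; under eq_bigr => k _ do 
     rewrite linearZl_LR linearZr_LR /= mulrA).
  over.
rewrite exchange_big /= mulr_sumr; apply: eq_bigr => j _.
rewrite exchange_big /= (bigD1 j) //= -mulr_suml sum_prim_root_conj // eqxx.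
rewrite big1 ?addr0 // => k kj.
by rewrite -mulr_suml sum_prim_root_conj // eq_sym (negPf kj) mul0r.
Qed.

(** * Pointwise rules for bounded operators *)

Lemma bop0r (R : realType) (H : normedModType (cplx R)) (T : bop H) : T 0 = 0.
Proof.
apply: rnorm_eq0; apply/le_anti.
by rewrite rnorm_ge0 andbT (le_trans (ler_opnorm T 0)) // rnorm0 mulr0.
Qed.

Lemma bopDr (R : realType) (H : normedModType (cplx R)) (T : bop H) x y :
  T (x + y) = T x + T y.
Proof. by have := bop_linear T 1 x y; rewrite !scale1r. Qed.

Lemma bopZr (R : realType) (H : normedModType (cplx R)) (T : bop H) a x :
  T (a *: x) = a *: T x.
Proof. by have := bop_linear T a x 0; rewrite bop0r !addr0. Qed.

Lemma bop_sum (R : realType) (H : normedModType (cplx R)) (I : Type)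
    (s : seq I) (P : pred I) (F : I -> bop H) x :
  (\sum_(i <- s | P i) F i) x = \sum_(i <- s | P i) F i x.
Proof. exact: (big_morph (fun T : bop H => T x)). Qed.

(** * A Toeplitz inequality for operator coefficients *)

Section hilbert.
Variables (R : realType) (H : normedModType (cplx R)).
Variable dot : {dot H for Num.conj}.
Hypothesis H_hilbert : forall x : H, `|x| ^+ 2 = dot x x.
Implicit Types (A : nat -> bop H) (x y : H).

Lemma dotE x : dot x x = of_real (rnorm x ^+ 2).
Proof. by rewrite -H_hilbert rnormE /of_real -(rmorphXn (real_complex R)). Qed.

Lemma parseval_rnorm (M : nat) (z : cplx R) (B : nat -> H) :
  M.-primitive_root z ->
  \sum_(i < M) rnorm (\sum_(j < M) (z ^+ i) ^+ j *: B j) ^+ 2 =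
  M%:R * \sum_(j < M) rnorm (B j) ^+ 2.
Proof.
move=> zM; apply: (@complexI R).
have := parseval_roots_of_unity dot B zM.
under eq_bigr do rewrite dotE.
under [X in _ = _ * X -> _]eq_bigr do rewrite dotE.
by rewrite /of_real -!(rmorph_sum (real_complex R)) -(rmorph_nat (real_complex
  R)) -rmorphM.
Qed.

(* Multiply the partial sum by [x + z ^ k y] and average over the [M]-th roots of
   unity: with [M = N + k] no two exponents are congruent modulo [M]. *)
Lemma toeplitz_le A (N k : nat) (c : R) x y : (0 < k < N)%N ->
  (forall z : cplx R, `|z| = 1 -> opnorm (\sum_(j < N) z ^+ j *: A j) <= c) ->
  rnorm (A 0%N x) ^+ 2 + rnorm (A k x + A 0%N y) ^+ 2 <=
  c ^+ 2 * (rnorm x ^+ 2 + rnorm y ^+ 2).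
Proof.
move=> /andP[k0 kN] gc; pose M := (N + k)%N.
have kM : (k < M)%N by rewrite /M; lia.
have M0 : (0 < M)%N by lia.
have [z zM] := prim_root_exists (cplx R) M0.
have nz : `|z| = 1.
  apply/eqP; rewrite -(@pexpr_eq1 _ _ M) //.
  by rewrite -normrX prim_expr_order // normr1.
have nzi i : `|z ^+ i| = 1 by rewrite normrX nz expr1n.
(* [B] lists the coefficients of the product of the partial sum by [x + w ^+ k *: y], and [B'] those
   of the second factor; both have degree below [M]. *)
pose B j := (if (j < N)%N then A j x else 0) + (if (k <= j)%N then A (j - k)%N
  y else 0).
pose B' j := (if j == 0%N then x else 0) + (if j == k then y else 0).
have BE (w : cplx R) : \sum_(j < M) w ^+ j *: B j =
    (\sum_(j < N) w ^+ j *: A j) (\sum_(j < M) w ^+ j *: B' j).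
  have -> : \sum_(j < M) w ^+ j *: B' j = x + w ^+ k *: y.
    under eq_bigr do rewrite scalerDr.
    rewrite big_split /=; congr (_ + _).
      rewrite (bigD1 (Ordinal M0)) //= big1 ?addr0 ?scale1r // => i /negPf.
      by rewrite -val_eqE /= => ->; rewrite scaler0.
    rewrite (bigD1 (Ordinal kM)) //= eqxx big1 ?addr0 // => i /negPf.
    by rewrite -val_eqE /= => ->; rewrite scaler0.
  rewrite bopDr bopZr !bop_sum scaler_sumr.
  under eq_bigr do rewrite scalerDr.
  rewrite big_split /=; congr (_ + _).
    rewrite -(big_mkord xpredT (fun j => w ^+ j *: (if (j < N)%N then A j x
      else 0))).
    rewrite (@big_cat_nat _ _ _ N) //=; last by rewrite /M leq_addr.
    rewrite [X in _ + X]big_nat_cond [X in _ + X]big1 ?addr0; last first.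
      by move=> i /andP[/andP[Ni _] _]; rewrite ltnNge Ni scaler0.
    by rewrite big_mkord; apply: eq_bigr => i _; rewrite ltn_ord.
  rewrite -(big_mkord xpredT (fun j => w ^+ j *: (if (k <= j)%N then A (j -
    k)%N y else 0))).
  rewrite (@big_cat_nat _ _ _ k) //=; last by rewrite ltnW.
  rewrite big_nat_cond big1 ?add0r; last first.
    by move=> i /andP[/andP[_ ik] _]; rewrite leqNgt ik scaler0.
  rewrite -{1}(add0n k) big_addn /M addnK big_mkord; apply: eq_bigr => i _.
  by rewrite leq_addl addnK addnC exprD scalerA.
(* Of the Parseval sum only the coefficients of index 0 and [k] are kept. *)
have lo : rnorm (B 0%N) ^+ 2 + rnorm (B k) ^+ 2 <= \sum_(j < M) rnorm (B j) ^+
  2.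
  rewrite (bigD1 (Ordinal M0)) //= (bigD1 (Ordinal kM)) /=; last by rewrite
    -val_eqE /= -lt0n.
  by rewrite addrA lerDl sumr_ge0 // => i _; rewrite exprn_ge0 ?rnorm_ge0.
have hi : \sum_(j < M) rnorm (B' j) ^+ 2 = rnorm x ^+ 2 + rnorm y ^+ 2.
  rewrite (bigD1 (Ordinal M0)) //= (bigD1 (Ordinal kM)) /=; last by rewrite
    -val_eqE /= -lt0n.
  rewrite big1 => [|i /andP[/negPf i0 /negPf ik]].
    by rewrite /B' /= eqxx (gtn_eqF k0) (ltn_eqF k0) addr0 add0r addr0.
  by move: i0 ik; rewrite -!val_eqE /B' /= => -> ->; rewrite addr0 rnorm0
    expr0n.
have c0 : 0 <= c by rewrite (le_trans (opnorm_ge0 _) (gc 1 _)) // normr1.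
have -> : A 0%N x = B 0%N by rewrite /B (ltn_trans k0 kN) leqNgt k0 addr0.
have -> : A k x + A 0%N y = B k by rewrite /B kN leqnn subnn.
(* Parseval turns both sides into sums over the roots of unity, which are compared root by root with
   the bound [c]. *)
rewrite (le_trans lo) // -hi -(@ler_pM2l _ M%:R) ?ltr0n // mulrCA.
rewrite -!(parseval_rnorm _ zM) mulr_sumr; apply: ler_sum => i _.
rewrite BE -exprMn lerXn2r ?nnegrE ?mulr_ge0 ?rnorm_ge0 //.
by rewrite (le_trans (ler_opnorm _ _)) // ler_wpM2r ?rnorm_ge0 // gc.
Qed.
End hilbert.

(** * Real numbers inside the complex field, and the real-valued modulus *)

Section of_real.
Variable R : realType.
Implicit Types x y : R.

Lemma of_realD x y : of_real (x + y) = of_real x + of_real y.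
Proof. exact: (rmorphD (real_complex R)). Qed.

Lemma of_realM x y : of_real (x * y) = of_real x * of_real y.
Proof. exact: (rmorphM (real_complex R)). Qed.

Lemma of_realN x : of_real (- x) = - of_real x.
Proof. exact: (rmorphN (real_complex R)). Qed.

Lemma of_real1 : of_real 1 = 1 :> cplx R.
Proof. by []. Qed.

Lemma of_real0 : of_real 0 = 0 :> cplx R.
Proof. by []. Qed.

Lemma of_real_le x y : (of_real x <= of_real y) = (x <= y).
Proof. exact: lecR. Qed.

Lemma of_real_lt x y : (of_real x < of_real y) = (x < y).
Proof. exact: ltcR. Qed.
End of_real.

Definition cmod (R : realType) (a : cplx R) : R := complex.Re (`|a| : R[i]).

Section cmod.
Variable R : realType.
Implicit Types a b : cplx R.

Lemma cmodE a : `|a| = of_real (cmod a).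
Proof. exact: (@rnormE R (cplx R)^o a). Qed.

Lemma cmod_ge0 a : 0 <= cmod a.
Proof. exact: (@rnorm_ge0 R (cplx R)^o a). Qed.

Lemma cmodM a b : cmod (a * b) = cmod a * cmod b.
Proof. exact: (@rnormZ R (cplx R)^o a b). Qed.

Lemma cmodX a n : cmod (a ^+ n) = cmod a ^+ n.
Proof.
elim: n => [|n IH]; first by rewrite !expr0 /cmod normr1.
by rewrite !exprS cmodM IH.
Qed.

Lemma cmod_real (x : R) : 0 <= x -> cmod (of_real x) = x.
Proof. by move=> x0; rewrite /cmod /of_real ger0_norm // ler0c. Qed.

Lemma cmodN a : cmod (- a) = cmod a.
Proof. by rewrite /cmod normrN. Qed.

Lemma cmod_conj a : cmod (Num.conj a) = cmod a.
Proof. by rewrite /cmod norm_conjC. Qed.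

Lemma mul_conj a : a * Num.conj a = of_real (cmod a ^+ 2).
Proof. by rewrite -normCK cmodE /of_real (rmorphXn (real_complex R)). Qed.

Lemma norm_lt1 a : (`|a| < 1) = (cmod a < 1).
Proof. by rewrite cmodE /of_real -(rmorph1 (real_complex R)) ltcR. Qed.

Lemma norm_eq1 a : `|a| = 1 -> cmod a = 1.
Proof. by rewrite /cmod => ->. Qed.
Lemma cmod_sqr a :
  cmod a ^+ 2 = complex.Re (a : R[i]) ^+ 2 + complex.Im (a : R[i]) ^+ 2.
Proof. by rewrite /cmod normc_def /= sqr_sqrtr // addr_ge0 // sqr_ge0. Qed.
End cmod.

(** * Passages to the limit in real inequalities *)

Lemma le_of_le_mul_sqr (R : realType) (a b : R) : 0 <= b ->
  (forall e, 0 < e -> a <= (1 + e) ^+ 2 * b) -> a <= b.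
Proof.
move=> b0 ab; apply/ler_addgt0Pr => e e0.
(* For [d <= 1], [(1 + d) ^+ 2 <= 1 + 3 * d], so the excess is at most [3 * b * d <= e]; the added 1
   keeps the denominator positive. *)
pose d := Num.min 1 (e / (3 * b + 1)).
have b1 : 0 < 3 * b + 1 by lra.
have d0 : 0 < d by rewrite lt_min ltr01 divr_gt0.
have d1 : d <= 1 by rewrite ge_min lexx.
have de : d * (3 * b + 1) <= e.
  by rewrite -ler_pdivlMr // ge_min lexx orbT.
rewrite (le_trans (ab d d0)) //; nra.
Qed.

(** Lets [r] tend to 1 by Bernoulli's inequality, applied to [r = 1 - d]. *)
Lemma le_of_expr_mul_le (R : realType) (a b : R) (k : nat) : 0 <= a ->
  (forall r, 0 < r < 1 -> r ^+ k * a <= b) -> a <= b.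
Proof.
move=> a0 ab; apply/ler_addgt0Pr => e e0.
have c0 : 0 < k%:R * a + 1 by rewrite ltr_wpDl // mulr_ge0.
pose d := Num.min (1 / 2) (e / (k%:R * a + 1)).
have d0 : 0 < d by rewrite lt_min !divr_gt0.
have d1 : d <= 1 / 2 by rewrite ge_min lexx.
have de : d * (k%:R * a + 1) <= e.
  by rewrite -ler_pdivlMr // ge_min lexx orbT.
have bern : 1 - k%:R * d <= (1 - d) ^+ k.
  elim: (k) => [|j IH]; first by rewrite mul0r subr0.
  rewrite exprS -natr1; have j0 : 0 <= j%:R :> R by [].
  rewrite (le_trans _ (ler_wpM2l _ IH)); nra.
have := ab (1 - d); rewrite subr_gt0 gtrBl d0 (le_lt_trans d1) ?andbT; last by
  lra.
move=> /(_ isT); nra.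
Qed.

(** * Estimates in the operator norm *)

Section opnorm.
Variables (R : realType) (H : normedModType (cplx R)).
Implicit Types (A : nat -> bop H).

Lemma opnormD (S T : bop H) : opnorm (S + T) <= opnorm S + opnorm T.
Proof. exact: (@ler_rnormD R (bop H) S T). Qed.

Lemma opnormB (S T : bop H) : opnorm S <= opnorm T + opnorm (S - T).
Proof. by rewrite -{1}(subrKC T S) opnormD. Qed.

Lemma opnormZE (a : cplx R) (S : bop H) : opnorm (a *: S) = cmod a * opnorm S.
Proof. exact: (@rnormZ R (bop H) a S). Qed.

Lemma opnorm_idop_le : opnorm (idop H) <= 1.
Proof. by apply: opnorm_le => // x; rewrite mul1r. Qed.

Lemma opnorm_idop : (exists x : H, x <> 0) -> opnorm (idop H) = 1.
Proof.
move=> [x /eqP x0]; apply/le_anti; rewrite opnorm_idop_le /=.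
have x1 : 0 < rnorm x.
  by rewrite lt_neqAle rnorm_ge0 eq_sym andbT; apply: contra_neq x0 =>
    /rnorm_eq0.
by rewrite -(ler_pM2r x1) mul1r; exact: (ler_opnorm (idop H) x).
Qed.

Lemma opnorm_sum (I : Type) (s : seq I) (P : pred I) (F : I -> bop H) :
  opnorm (\sum_(i <- s | P i) F i) <= \sum_(i <- s | P i) opnorm (F i).
Proof.
elim/big_ind2: _ => [|S x T y Sx Ty|//]; first by rewrite [opnorm 0](@rnorm0 R
  (bop H)).
by rewrite (le_trans (opnormD _ _)) // lerD.
Qed.

Lemma cvg_opnorm_le (u : nat -> bop H) (l : bop H) (e : R) : 0 < e ->
  u @ \oo --> l -> \forall n \near \oo, opnorm (l - u n) <= e.
Proof.
move=> e0 /cvgrPdist_le /(_ (of_real e)).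
rewrite /of_real ltcR => /(_ e0); apply: filterS => n.
by rewrite bop_normE lecR.
Qed.

Lemma sum_geometric_le (r : R) (m n : nat) : 0 <= r < 1 ->
  \sum_(m <= j < n) r ^+ j <= r ^+ m / (1 - r).
Proof.
move=> /andP[r0 r1]; have q0 : 0 < 1 - r by rewrite subr_gt0.
have [nm|mn] := leqP n m; first by rewrite big_geq // divr_ge0 ?exprn_ge0 //
  ltW.
rewrite ler_pdivlMr // mulrC.
have -> : (1 - r) * \sum_(m <= j < n) r ^+ j = r ^+ m - r ^+ n.
  rewrite mulr_sumr (@telescope_sumr_eq _ _ _ (fun j => - r ^+ j)) 1?ltnW //.
    by rewrite opprK addrC.
  by move=> j _; rewrite exprS; ring.
by rewrite gerBl exprn_ge0.
Qed.

(** The whole sum has norm at most 1, and the tail from [N] on is dominated by a geometric series.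
    This passes from the bounded function to its partial sums, to which the Toeplitz inequality
    applies. *)
Lemma partial_sum_le A (C r : R) (z : cplx R) (g : bop H) (N : nat) :
  (forall j, opnorm (A j) <= C) -> 0 <= r < 1 -> cmod z = r ->
  series (fun j => z ^+ j *: A j) @ \oo --> g -> opnorm g <= 1 ->
  opnorm (\sum_(j < N) z ^+ j *: A j) <= 1 + C * (r ^+ N / (1 - r)).
Proof.
move=> AC r01 zr cg g1; apply/ler_addgt0Pr => e e0.
have C0 : 0 <= C by rewrite (le_trans (opnorm_ge0 (A 0%N))).
have [n /= Nn nP] : exists2 n, (N <= n)%N & opnorm (g - series (fun j => z ^+ j
  *: A j) n) <= e.
  have [m _ mP] := cvg_opnorm_le e0 cg.
  by exists (maxn N m); [exact: leq_maxl | apply: mP; exact: leq_maxr].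
set S := series _ n in nP.
have SN : S = \sum_(j < N) z ^+ j *: A j + \sum_(N <= j < n) z ^+ j *: A j.
  by rewrite /S /series /= (@big_cat_nat _ _ _ N) //= big_mkord.
have tail : opnorm (\sum_(N <= j < n) z ^+ j *: A j) <= C * (r ^+ N / (1 - r)).
  rewrite (le_trans (opnorm_sum _ _ _)) //.
  rewrite (le_trans _ (ler_wpM2l C0 (sum_geometric_le N n r01))) // mulr_sumr.
  apply: ler_sum => j _; rewrite opnormZE cmodX zr mulrC ler_wpM2r //.
  by rewrite exprn_ge0 //; case/andP: r01.
have h1 := opnormB (\sum_(j < N) z ^+ j *: A j) S.
have h2 := opnormB S g.
have e1 : opnorm (\sum_(j < N) z ^+ j *: A j - S) = opnorm (\sum_(N <= j < n) z
  ^+ j *: A j).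
  by rewrite SN opprD addNKr [LHS](_ : _ = rnorm (- (\sum_(N <= j < n) z ^+ j
    *: A j))) // /rnorm normrN.
have e2 : opnorm (S - g) = opnorm (g - S).
  by rewrite [LHS](_ : _ = rnorm (S - g)) // /rnorm distrC.
rewrite e1 in h1; rewrite e2 in h2; lra.
Qed.
End opnorm.

(** * The Schwarz-Pick bound on the coefficients *)

Section schwarz_pick.
Variables (R : realType) (H : normedModType (cplx R)).
Variable dot : {dot H for Num.conj}.
Hypothesis H_hilbert : forall x : H, `|x| ^+ 2 = dot x x.
Implicit Types (A : nat -> bop H).

(** With [b = cmod a0] and [s = 1 / (1 - b ^+ 2)], the best [y] gives [v + a0 *: y = s *: v] and a
    gain of [s * rnorm v ^+ 2]. This is at most [(1 - b ^+ 2) * rnorm x ^+ 2], and a square root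
    remains to be taken. *)
Lemma schwarz_pick_algebra (a0 : cplx R) (x v : H) : cmod a0 < 1 ->
  (forall y, rnorm (a0 *: x) ^+ 2 + rnorm (v + a0 *: y) ^+ 2 <=
     rnorm x ^+ 2 + rnorm y ^+ 2) ->
  rnorm v <= (1 - cmod a0 ^+ 2) * rnorm x.
Proof.
set b := cmod a0 => b1.
have b0 : 0 <= b by exact: cmod_ge0.
have q0 : 0 < 1 - b ^+ 2 by nra.
pose s := (1 - b ^+ 2)^-1.
have sq : s * (1 - b ^+ 2) = 1 by rewrite mulVf // gt_eqF.
have s0 : 0 < s by rewrite invr_gt0.
(* This [y] maximises the gain [|v + a0 y|^2 - |y|^2]. *)
move=> /(_ ((of_real s * Num.conj a0) *: v)).
have -> : v + a0 *: ((of_real s * Num.conj a0) *: v) = of_real s *: v.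
  rewrite scalerA mulrCA mul_conj -/b /of_real -rmorphM.
  rewrite -[X in X + _]scale1r -scalerDl -(rmorph1 (real_complex R)) -rmorphD.
  by congr (_ *: _); congr (real_complex R _); rewrite -sq; ring.
rewrite !rnormZ -!/(cmod _) cmodM cmod_conj cmod_real ?(ltW s0) // -/b.
have v0 := rnorm_ge0 v; have x0 := rnorm_ge0 x => h.
rewrite -(@ler_pXn2r _ 2) ?nnegrE ?mulr_ge0 ?(ltW q0) //.
have h2 : s * rnorm v ^+ 2 <= (1 - b ^+ 2) * rnorm x ^+ 2.
  have -> : s * rnorm v ^+ 2 = s ^+ 2 * rnorm v ^+ 2 * (1 - b ^+ 2).
    transitivity (s * (s * (1 - b ^+ 2)) * rnorm v ^+ 2); last by ring.
    by rewrite sq mulr1.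
  by move: h; rewrite !exprMn; lra.
have -> : rnorm v ^+ 2 = (1 - b ^+ 2) * (s * rnorm v ^+ 2).
  by rewrite mulrCA mulrA sq mul1r.
by rewrite exprMn exprS expr1 -mulrA ler_wpM2l // ltW.
Qed.

(** The Toeplitz inequality is applied on the circle of radius [r < 1], that is, to the coefficients
    [r ^+ j *: A j], whose partial sums are bounded by [1 + e] for large [N]. Then [e] tends to 0
    and [r] to 1. *)
Lemma coef_le A (a0 : cplx R) (C : R) (g : cplx R -> bop H) :
  A 0%N = a0 *: idop H -> cmod a0 < 1 ->
  (forall j, opnorm (A j) <= C) ->
  (forall z, cmod z < 1 -> series (fun j => z ^+ j *: A j) @ \oo --> g z) ->
  (forall z, cmod z < 1 -> opnorm (g z) <= 1) ->
  forall k, (0 < k)%N -> opnorm (A k) <= 1 - cmod a0 ^+ 2.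
Proof.
move=> A0 a1 AC cg g1 k k0.
have b0 := cmod_ge0 a0.
apply: opnorm_le => [|x]; first by nra.
apply: (@le_of_expr_mul_le _ _ _ k (rnorm_ge0 _)) => r /andP[r0 r1].
have r01 : 0 <= r < 1 by rewrite ltW.
have cr : cmod (of_real r) = r by rewrite cmod_real // ltW.
rewrite -[X in X <= _](_ : rnorm (of_real r ^+ k *: A k x) = _); last first.
  by rewrite rnormZ -/(cmod _) cmodX cr.
apply: schwarz_pick_algebra => // y.
apply: le_of_le_mul_sqr => [|e e0]; first by rewrite addr_ge0 ?exprn_ge0
  ?rnorm_ge0.
have [N kN Ne] : exists2 N, (k < N)%N & C * (r ^+ N / (1 - r)) <= e.
  have : geometric (C / (1 - r)) r @ \oo --> 0.
    by apply: cvg_geometric; rewrite ger0_norm // ltW.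
  move=> /cvgrPdist_le /(_ e e0)[m _ mP]; exists (maxn m k.+1); first exact:
    leq_maxr.
  have /= := mP (maxn m k.+1) (leq_maxl _ _); rewrite sub0r normrN.
  move=> /(le_trans (ler_norm _)); apply: le_trans.
  by rewrite mulrA mulrAC.
pose A' j := of_real r ^+ j *: A j.
have kN' : (0 < k < N)%N by rewrite k0.
have := @toeplitz_le _ _ _ H_hilbert A' N k (1 + e) x y kN'.
rewrite /A' expr0 scale1r A0 !bopZ /=; apply => z z1.
have zr : cmod (z * of_real r) = r by rewrite cmodM norm_eq1 // mul1r cr.
have zr1 : cmod (z * of_real r) < 1 by rewrite zr.
have -> : \sum_(j < N) z ^+ j *: (of_real r ^+ j *: A j) =
    \sum_(j < N) (z * of_real r) ^+ j *: A j.
  by apply: eq_bigr => j _; rewrite scalerA exprMn.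
rewrite (le_trans (partial_sum_le N AC r01 zr (cg _ zr1) (g1 _ zr1))) //.
by rewrite lerD2l.
Qed.

End schwarz_pick.

(** * Homogeneity and the scalar estimates behind the constants 1/3 and 3/8 *)

Lemma homogeneous_polyZ (R : realType) (n : nat) (H : normedModType (cplx R))
    (k : nat) (p : 'rV[cplx R]_n -> bop H) (xi : cplx R) (z : 'rV[cplx R]_n) :
  homogeneous_poly k p -> p (xi *: z) = xi ^+ k *: p z.
Proof.
move=> [A pA]; rewrite !pA scaler_sumr; apply: eq_bigr => al /eqP alk.
rewrite scalerA; congr (_ *: _).
have -> : xi ^+ k = \prod_i xi ^+ al i.
  by rewrite -{1}alk (big_morph _ (exprD xi) (expr0 xi)).
rewrite -big_split /=.
by apply: eq_bigr => i _; rewrite mxE exprMn.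
Qed.

(** The partial sum has a closed form, proved by induction. At [q = 1 / 9] the bound equals
    [(3 / 8) ^+ 2]. *)
Lemma sum_natmul_expr_le (R : realType) (q : R) (N : nat) : 0 <= q < 1 ->
  \sum_(0 <= k < N) k%:R * q ^+ k <= q / (1 - q) ^+ 2.
Proof.
move=> /andP[q0 q1]; have p0 : 0 < 1 - q by rewrite subr_gt0.
rewrite ler_pdivlMr ?exprn_gt0 //.
have -> : (\sum_(0 <= k < N) k%:R * q ^+ k) * (1 - q) ^+ 2 =
    q - q ^+ N * (N%:R * (1 - q) + q).
  elim: N => [|N IH]; first by rewrite big_geq // mul0r expr0 mul0r add0r mul1r
    subrr.
  by rewrite big_nat_recr //= mulrDl IH -[N.+1%:R]natr1 [q ^+ N.+1]exprS; ring.
by rewrite gerBl mulr_ge0 ?exprn_ge0 // addr_ge0 // mulr_ge0 // ltW.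
Qed.

(** The right-hand side is exactly what [b + (1 - b ^+ 2) / 2] leaves below 1. Multiplying the
    hypothesis on [c] by it reduces the claim to a comparison term by term. *)
Lemma bohr_polynomial_le (R : realType) (l : nat) (c : nat -> R) (b S : R) :
  (forall m, (1 <= m <= l)%N -> 0 <= c m) ->
  \sum_(1 <= m < l.+1) 8 * (2 * m - 1)%N%:R * c m * (3 / 8) ^+ (2 * m) <= 1 ->
  0 <= b < 1 -> 0 <= S <= (3 / 8 * (1 - b ^+ 2)) ^+ 2 ->
  \sum_(1 <= m < l.+1) c m * S ^+ m <= (1 - b) ^+ 2 / 2.
Proof.
move=> c0 c1 /andP[b0 b1] /andP[S0 S1].
have d0 : 0 <= (1 - b) ^+ 2 / 2 by rewrite divr_ge0 // sqr_ge0.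
rewrite (le_trans _ (ler_piMr d0 c1)) // mulr_sumr big_nat_cond
  [leRHS]big_nat_cond.
apply: ler_sum => m /andP[/andP[m1 ml] _].
have cm : 0 <= c m by apply: c0; rewrite m1.
have m2 : 1 <= (2 * m - 1)%N%:R :> R by rewrite (_ : 1 = 1%:R) // ler_nat; lia.
have tm : 0 <= (3 / 8) ^+ (2 * m) :> R by rewrite exprn_ge0 // divr_ge0.
have p0 : 0 <= 1 - b ^+ 2 by nra.
have p1 : 1 - b ^+ 2 <= 1 by nra.
have q0 : 0 <= (1 - b ^+ 2) ^+ 2 by exact: exprn_ge0.
have q1 : (1 - b ^+ 2) ^+ 2 <= 1 by rewrite exprn_ile1.
(* Since [(1 - b ^+ 2) ^+ 2] is at most 1, its [m]-th power is at most itself; then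
   [1 - b ^+ 2 = (1 + b) * (1 - b)] and [1 + b <= 2]. *)
have Sm : S ^+ m <= (3 / 8) ^+ (2 * m) * (4 * (1 - b) ^+ 2).
  apply: (@le_trans _ _ ((3 / 8) ^+ (2 * m) * (1 - b ^+ 2) ^+ 2)); last first.
    rewrite ler_wpM2l //.
    have -> : (1 - b ^+ 2) ^+ 2 = (1 + b) ^+ 2 * (1 - b) ^+ 2 by ring.
    by rewrite ler_wpM2r ?sqr_ge0 //; nra.
  apply: (@le_trans _ _ (((3 / 8 * (1 - b ^+ 2)) ^+ 2) ^+ m)).
    by rewrite lerXn2r // nnegrE // sqr_ge0.
  rewrite -exprM exprMn [(1 - _) ^+ (2 * m)]exprM ler_wpM2l //.
  by rewrite -[leRHS]expr1 ler_wiXn2l.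
rewrite (le_trans (ler_wpM2l cm Sm)) //.
set t := (3 / 8) ^+ _ in tm *; set d := (1 - b) ^+ 2 in d0 *.
have -> : c m * (t * (4 * d)) = c m * t * (d / 2) * 8 by field.
have -> : d / 2 * (8 * (2 * m - 1)%:R * c m * t) = c m * t * (d / 2) * (8 * (2
  * m - 1)%:R).
  by ring.
have w0 : 0 <= c m * t * (d / 2) by rewrite mulr_ge0 // mulr_ge0.
by rewrite ler_wpM2l // ler_peMr.
Qed.

(** * The Bohr inequality on one third of the domain *)

Section bohr_inequality.
Variables (R : realType) (H : normedModType (cplx R)).
Variable dot : {dot H for Num.conj}.
Hypothesis H_hilbert : forall x : H, `|x| ^+ 2 = dot x x.
Variables (n : nat) (Q : set 'rV[cplx R]_n).
Hypothesis Q_circular : complete_circular_domain Q.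
Implicit Types (P : nat -> 'rV[cplx R]_n -> bop H) (f : 'rV[cplx R]_n -> bop H).

(** Homogeneity makes [P 0] constant and every other [P k] zero at the origin, so the constant is
    [f 0]. *)
Lemma expansion0 P f a0 w : contractive_expansion Q P f a0 ->
  P 0%N w = a0 *: idop H.
Proof.
move=> [hP cf _ _ [f0 _]].
have [_ _ Q0 _] := Q_circular.
have P0 k z : P k (0 *: z) = 0 ^+ k *: P k z by exact: homogeneous_polyZ.
have -> : P 0%N w = P 0%N 0 by rewrite -(scale0r w) P0 expr0 scale1r.
rewrite -f0; apply: (@cvg_unique _ (@norm_hausdorff _ (bop H)) _ _ _ _ _ (cf 0
  Q0)).
apply: cvg_near_cst; exists 1%N => // m /= m1; rewrite /series /=.
rewrite big_ltn // big_nat_cond big1 ?addr0 // => i /andP[/andP[i1 _] _].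
by rewrite -[X in P i X](scale0r 0) P0 expr0n gtn_eqF // scale0r.
Qed.

Lemma expansion_coef_le P f a0 w (k : nat) : contractive_expansion Q P f a0 ->
  Q w -> (0 < k)%N -> opnorm (P k w) <= 1 - cmod a0 ^+ 2.
Proof.
move=> Pf Qw k0; have P0 := expansion0 w Pf.
have [hP cf area f1 [_ a01]] := Pf.
have [_ _ _ Qc] := Q_circular.
(* The terms of the convergent area series are bounded by some [B], so [p ^+ 2 <= B] and
   [p <= 1 + B] for positive indices. Index 0 is treated apart, its term being 0. *)
have [C PC] : exists C, forall j, opnorm (P j w) <= C.
  have := cvg_series_cvg_0 (area w Qw).
  move=> /cvgP /cvg_seq_bounded /pinfty_ex_gt0[B B0 hB].
  exists (1 + B + opnorm (P 0%N w)) => j.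
  have p0 := opnorm_ge0 (P 0%N w); case: j => [|j]; first by lra.
  have := hB j.+1 I; rewrite /= ger0_norm ?mulr_ge0 ?opnorm_ge0 //.
  have := opnorm_ge0 (P j.+1 w); set p := opnorm (P _ w) => pj.
  have j1 : 1 <= j.+1%:R :> R by rewrite ler1n.
  nra.
apply: (@coef_le _ _ _ H_hilbert (P ^~ w) a0 C (fun z => f (z *: w))) => //.
- by rewrite -norm_lt1.
- move=> z z1; have Qzw : Q (z *: w) by apply: Qc => //; rewrite ltW //
  norm_lt1.
  have <- : P ^~ (z *: w) = fun j => z ^+ j *: P j w.
    by apply/funext => j; rewrite (homogeneous_polyZ _ _ (hP j)).
  exact: cf.
- move=> z z1; have Qzw : Q (z *: w) by apply: Qc => //; rewrite ltW //
  norm_lt1.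
  have := f1 _ Qzw; rewrite bop_normE /of_real -(rmorph1 (real_complex R)) ltcR.
  exact: ltW.
Qed.

(** With [b = cmod a0], the norm series is at most [b + (1 - b ^+ 2) / 2] and the polynomial term at
    most [(1 - b) ^+ 2 / 2]; these add up to 1. *)
Lemma bohr_sum_le1 (l : nat) (c : nat -> R) :
  (forall m, (1 <= m <= l)%N -> 0 <= c m) ->
  \sum_(1 <= m < l.+1) 8 * (2 * m - 1)%N%:R * c m * (3 / 8) ^+ (2 * m) <= 1 ->
  forall P f a0, contractive_expansion Q P f a0 ->
  forall z, homothety (1 / 3) Q z ->
  (bohr_sum (\sum_(1 <= m < l.+1) c m *: 'X^m)%R P z <= 1)%E.
Proof.
move=> c0 c1 P f a0 Pf _ [w Qw <-].
have b0 := cmod_ge0 a0; have b1 : cmod a0 < 1 by case: Pf => _ _ _ _ [];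
  rewrite norm_lt1.
set b := cmod a0 in b0 b1; set z := _ *: w.
have [_ _ _ Qc] := Q_circular; have [hP _ area _ _] := Pf.
have Qz : Q z.
  apply: Qc => //; rewrite cmodE cmod_real ?divr_ge0 //.
  by rewrite /of_real -(rmorph1 (real_complex R)) lecR; lra.
have Pz k : opnorm (P k z) = (1 / 3) ^+ k * opnorm (P k w).
  by rewrite (homogeneous_polyZ _ _ (hP k)) opnormZE cmodX cmod_real //
    divr_ge0.
(* Only an inequality, because the identity of the zero space has norm 0. *)
have P0 : opnorm (P 0%N z) <= b.
  rewrite (expansion0 z Pf) opnormZE -/b.
  by rewrite ler_piMr // opnorm_idop_le.
have Pk k : (0 < k)%N -> opnorm (P k z) <= (1 / 3) ^+ k * (1 - b ^+ 2).
  move=> k0; rewrite Pz ler_wpM2l ?exprn_ge0 ?divr_ge0 //.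
  exact: expansion_coef_le Pf Qw k0.
have p0 : 0 <= 1 - b ^+ 2 by nra.
have sumP N : \sum_(0 <= k < N) opnorm (P k z) <= b + (1 - b ^+ 2) / 2.
  case: N => [|N]; first by rewrite big_geq //; lra.
  rewrite big_ltn // lerD //.
  have q01 : 0 <= (1 / 3 : R) < 1 by apply/andP; split; lra.
  have := ler_wpM2r p0 (sum_geometric_le 1 N.+1 q01).
  have -> : (1 / 3 : R) ^+ 1 / (1 - 1 / 3) * (1 - b ^+ 2) = (1 - b ^+ 2) / 2 by
    field.
  apply: le_trans; rewrite mulr_suml big_nat_cond [leRHS]big_nat_cond.
  by apply: ler_sum => k /andP[/andP[k1 _] _]; exact: Pk.
set S := limn (area_series P z).
have area_ge0 N : 0 <= area_series P z N.
  by rewrite sumr_ge0 // => k _; rewrite mulr_ge0 // sqr_ge0.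
have S0 : 0 <= S by apply: limr_ge; [exact: area | exact: nearW].
(* Squaring the bounds of ratio 1/3 gives the ratio 1/9, whence the constant 3/8. *)
have S1 : S <= (3 / 8 * (1 - b ^+ 2)) ^+ 2.
  apply: limr_le; [exact: area | apply: nearW => N].
  have q01 : 0 <= (1 / 9 : R) < 1 by apply/andP; split; lra.
  have := ler_wpM2l (sqr_ge0 (1 - b ^+ 2)) (sum_natmul_expr_le N q01).
  have -> : (1 - b ^+ 2) ^+ 2 * (1 / 9 / (1 - 1 / 9) ^+ 2) = (3 / 8 * (1 - b ^+
    2)) ^+ 2 by field.
  apply: le_trans; rewrite mulr_sumr; apply: ler_sum => k _.
  case: k => [|k]; first by rewrite !mul0r mulr0.
  rewrite [leRHS]mulrCA ler_wpM2l //.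
  rewrite (@le_trans _ _ (((1 / 3) ^+ k.+1 * (1 - b ^+ 2)) ^+ 2)) //.
    by rewrite lerXn2r ?nnegrE ?opnorm_ge0 ?mulr_ge0 ?exprn_ge0 ?divr_ge0 ?Pk.
  rewrite exprMn mulrC -exprM mulnC exprM.
  by rewrite (_ : (1 / 3) ^+ 2 = 1 / 9 :> R) //; field.
have GS : (\sum_(1 <= m < l.+1) c m *: 'X^m).[S] <= (1 - b) ^+ 2 / 2.
  rewrite horner_sum; under eq_bigr do rewrite hornerZ hornerXn.
  by apply: bohr_polynomial_le => //; rewrite ?b0 ?S0.
have sE : (\sum_(0 <= k <oo) (opnorm (P k z))%:E <= (b + (1 - b ^+ 2) /
  2)%:E)%E.
  apply: lime_le.
    by apply: is_cvg_nneseries => k _ _; rewrite lee_fin opnorm_ge0.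
  by apply: nearW => N; rewrite sumEFin lee_fin.
rewrite /bohr_sum -/S (le_trans (leeD sE (_ : (_ <= ((1 - b) ^+ 2 / 2)%:E)%E)))
  //.
  by rewrite -EFinD lee_fin; lra.
Qed.
End bohr_inequality.

(** * Hahn-Banach extension over a finite family of vectors *)

Section hahn_banach.
Variables (R : realType) (V : lmodType (cplx R)) (E : R -> V -> Prop).
Hypothesis ED : forall s t x y, 0 < s -> 0 < t -> E s x -> E t y -> E (s + t)
  (x + y).
Hypothesis EZ : forall c s x, 0 < c -> 0 < s -> E s x -> E (c * s) (of_real c
  *: x).
Hypothesis E_absorb : forall x, exists2 s, 0 < s & E s x.

(* [E s x] stands for [x] lying in [s Q] and plays the role of the inequality
   [gauge x <= s].  Functionals are given by their values [b i] on the family [v],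
   the value [1] at [p] being imposed; the family need not be free, because the
   domination by [E] forces the coordinates' functional to be well defined. *)
Lemma hahn_banach_step (p : V) (I : eqType) (v : I -> V) (r : seq I) (j : I)
    (b : I -> R) : j \notin r ->
  (forall t0 t s, 0 < s -> E s (of_real t0 *: p + \sum_(i <- r) of_real (t i)
    *: v i) ->
     t0 + \sum_(i <- r) t i * b i <= s) ->
  exists beta, forall t0 t s, 0 < s ->
    E s (of_real t0 *: p + \sum_(i <- r) of_real (t i) *: v i + of_real (t j)
      *: v j) ->
     t0 + \sum_(i <- r) t i * b i + t j * beta <= s.
Proof.
move=> jr hb.
pose X (t0 : R) (t : I -> R) := of_real t0 *: p + \sum_(i <- r) of_real (t i)
  *: v i.
pose L (t0 : R) (t : I -> R) := t0 + \sum_(i <- r) t i * b i.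
have XD t0 t u0 u : X t0 t + X u0 u = X (t0 + u0) (fun i => t i + u i).
  rewrite /X addrACA -scalerDl -of_realD -big_split; congr (_ + _).
  by apply: eq_bigr => i _ /=; rewrite -scalerDl -of_realD.
have LD t0 t u0 u : L t0 t + L u0 u = L (t0 + u0) (fun i => t i + u i).
  rewrite /L addrACA -big_split; congr (_ + _).
  by apply: eq_bigr => i _; rewrite mulrDl.
have XZ c t0 t : of_real c *: X t0 t = X (c * t0) (fun i => c * t i).
  rewrite /X scalerDr scalerA -of_realM scaler_sumr; congr (_ + _).
  by apply: eq_bigr => i _; rewrite scalerA -of_realM.
have LZ c t0 t : c * L t0 t = L (c * t0) (fun i => c * t i).
  rewrite /L mulrDr mulr_sumr; congr (_ + _).
  by apply: eq_bigr => i _; rewrite mulrA.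
have X0 : X 0 (fun=> 0) = 0.
  by rewrite /X of_real0 scale0r add0r big1 // => i _; rewrite scale0r.
(* The constraints with [t j = -1] bound [beta] from below by the elements of [lower], those with
   [t j = 1] from above; [ED] and [hb] show them compatible, so [beta] can be the supremum of
   [lower]. Scaling by [EZ] reduces any nonzero [t j] to these two cases. *)
pose lower := [set a : R | exists t0 t s, [/\ 0 < s, E s (X t0 t - v j) & a = L
  t0 t - s]].
have lower_le u0 u s' a : 0 < s' -> E s' (X u0 u + v j) -> lower a -> a <= s' -
  L u0 u.
  move=> s0 Eu [t0 [t [s [s1 Et ->]]]].
  have := ED s1 s0 Et Eu; rewrite addrACA addNr addr0 XD.
  move=> /(hb _ _ _ (addr_gt0 s1 s0)); rewrite -/(L _ _) -LD; lra.
have lower_sup : has_sup lower.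
  split.
    have [s s0 Es] := E_absorb (- v j).
    by exists (L 0 (fun=> 0) - s), 0, (fun=> 0), s; split => //; rewrite X0
      add0r.
  have [s s0 Es] := E_absorb (v j).
  exists (s - L 0 (fun=> 0)) => a; apply: lower_le => //.
  by rewrite X0 add0r.
exists (sup lower) => t0 t s s0; rewrite -/(X t0 t) -/(L t0 t).
have [tj|tj|->] := ltgtP (t j) 0; last first.
- by rewrite of_real0 scale0r addr0 mul0r addr0; exact: hb.
- move=> Es; have c0 : 0 < (t j)^-1 by rewrite invr_gt0.
  have := EZ c0 s0 Es; rewrite scalerDr scalerA -of_realM mulVf ?gt_eqF //
    of_real1 scale1r XZ.
  move=> /lower_le h; have : sup lower <= (t j)^-1 * s - (t j)^-1 * L t0 t.
    apply: ge_sup; first by case: lower_sup.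
    by move=> a la; rewrite LZ; apply: h => //; rewrite mulr_gt0.
  by rewrite -mulrBr ler_pdivlMl //; lra.
- move=> Es; have c0 : 0 < (- t j)^-1 by rewrite invr_gt0 oppr_gt0.
  have cj : (- t j)^-1 * t j = -1 by rewrite invrN mulNr mulVf ?lt_eqF.
  have := EZ c0 s0 Es; rewrite scalerDr scalerA -of_realM cj.
  rewrite of_realN of_real1 scaleN1r XZ => E'.
  have : (- t j)^-1 * L t0 t - (- t j)^-1 * s <= sup lower.
    apply: ub_le_sup; first by case: lower_sup.
    by rewrite LZ; eexists _, _, _; split; [|exact: E'|]; rewrite // mulr_gt0.
  by rewrite -mulrBr ler_pdivrMl ?oppr_gt0 //; lra.
Qed.

Lemma hahn_banach_seq (p : V) (I : eqType) (v : I -> V) (r : seq I) :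
  uniq r -> (forall t s, 0 < s -> E s (of_real t *: p) -> t <= s) ->
  exists b : I -> R, forall t0 t s, 0 < s ->
    E s (of_real t0 *: p + \sum_(i <- r) of_real (t i) *: v i) ->
    t0 + \sum_(i <- r) t i * b i <= s.
Proof.
move=> + hp; elim: r => [_|j r IH /= /andP[jr /IH[b hb]]].
  by exists (fun=> 0) => t0 t s s0; rewrite !big_nil !addr0; exact: hp.
have [beta hbeta] := hahn_banach_step jr hb.
exists (fun i => if i == j then beta else b i) => t0 t s s0.
rewrite !big_cons eqxx addrCA addrC => /(hbeta _ _ _ s0).
suff -> : \sum_(i <- r) t i * (if i == j then beta else b i) = \sum_(i <- r) t
  i * b i.
  by rewrite addrCA addrC.
rewrite !big_seq; apply: eq_bigr => i ir.
by case: eqVneq ir => // ->; rewrite (negPf jr).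
Qed.
End hahn_banach.

(** * Separation of a circular convex domain from an outside point *)

Section supporting_functional.
Variables (R : realType) (n : nat) (Q : set 'rV[cplx R]_n).
Hypothesis Q_circular : complete_circular_domain Q.
Hypothesis Q_convex : convex_set Q.

Lemma convex_comb (x y : 'rV[cplx R]_n) (t : R) : 0 <= t <= 1 -> Q x -> Q y ->
  Q (of_real t *: x + of_real (1 - t) *: y).
Proof.
move=> /andP[t0 t1] Qx Qy.
have t0' : 0 <= of_real t by rewrite -of_real0 of_real_le.
have t1' : of_real t <= 1 by rewrite -of_real1 of_real_le.
rewrite of_realD of_realN of_real1.
exact: set_mem (Q_convex (Itv01 t0' t1') (mem_set Qx) (mem_set Qy)).
Qed.

Lemma absorbing (x : 'rV[cplx R]_n) : exists2 d, 0 < d & forall e, 0 <= e <= d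
  -> Q (of_real e *: x).
Proof.
have [oQ _ Q0 _] := Q_circular.
have : \forall k \near (0 : cplx R), Q (k *: x).
  apply: (@scalel_continuous _ _ x 0); rewrite scale0r; exact: open_nbhs_nbhs.
move=> /nbhs_ballP[d /= d0 dQ].
have dE : d = of_real (cmod d) by rewrite -cmodE ger0_norm // ltW.
have c0 : 0 < cmod d by rewrite -of_real_lt -dE.
exists (cmod d / 2) => [|e /andP[e0 ed]]; first by rewrite divr_gt0.
apply: dQ; rewrite -ball_normE /= sub0r normrN cmodE cmod_real // dE
  of_real_lt; lra.
Qed.

(** Hahn-Banach over the real basis of [C^n] gives a real functional dominated by the gauge of [Q],
    with value 1 at [p]. It is the real part of a complex form, and invariance of [Q] under
    rotations turns the bound on the real part into one on the modulus. *)
Lemma supporting_functional (p : 'rV[cplx R]_n) : ~ Q p ->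
  exists phi : 'I_n -> cplx R,
    (forall z, Q z -> cmod (\sum_i phi i * z 0 i) <= 1) /\
    1 <= cmod (\sum_i phi i * p 0 i).
Proof.
move=> nQp.
have [_ _ Q0 Qc] := Q_circular.
pose E (s : R) (x : 'rV[cplx R]_n) := Q (of_real s^-1 *: x).
have ED s t x y : 0 < s -> 0 < t -> E s x -> E t y -> E (s + t) (x + y).
  move=> s0 t0 Es Et; have st0 : 0 < s + t by exact: addr_gt0.
  have st1 : 0 <= s / (s + t) <= 1.
    apply/andP; split; first by rewrite divr_ge0 // ltW.
    by rewrite ler_pdivrMr // mul1r lerDl ltW.
  have e1 : s / (s + t) * s^-1 = (s + t)^-1 by field; rewrite !gt_eqF.
  have e2 : (1 - s / (s + t)) * t^-1 = (s + t)^-1 by field; rewrite !gt_eqF.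
  have := convex_comb st1 Es Et.
  by rewrite !scalerA -!of_realM e1 e2 /E scalerDr.
have EZ c s x : 0 < c -> 0 < s -> E s x -> E (c * s) (of_real c *: x).
  move=> c0 s0; rewrite /E scalerA -of_realM.
  have -> : (c * s)^-1 * c = s^-1 by field; rewrite !gt_eqF.
  by [].
have E_absorb x : exists2 s, 0 < s & E s x.
  have [d d0 dQ] := absorbing x; exists d^-1; first by rewrite invr_gt0.
  by rewrite /E invrK; apply: dQ; rewrite ltW /=.
pose v (i : ('I_n + 'I_n)%type) : 'rV[cplx R]_n :=
  match i with inl j => delta_mx 0 j | inr j => 'i%C *: delta_mx 0 j end.
have Ep t s : 0 < s -> E s (of_real t *: p) -> t <= s.
  rewrite /E leNgt => s0 Es; apply/negP => st; apply: nQp.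
  have t0 := lt_trans s0 st.
  have -> : p = of_real (s / t) *: (of_real s^-1 *: (of_real t *: p)).
    rewrite !scalerA -!of_realM [X in of_real X](_ : _ = 1) ?scale1r //.
    by field; rewrite !gt_eqF.
  have r0 : 0 <= s / t by rewrite divr_ge0 // ltW.
  by apply: Qc => //; rewrite cmodE cmod_real // -of_real1 of_real_le
    ler_pdivrMr // mul1r ltW.
have [b hb] := hahn_banach_seq ED EZ E_absorb v (index_enum_uniq _) Ep.
pose co (z : 'rV[cplx R]_n) (i : ('I_n + 'I_n)%type) :=
  match i with inl j => complex.Re (z 0 j : R[i]) | inr j => complex.Im (z 0 j
    : R[i]) end.
have coE z : z = \sum_i of_real (co z i) *: v i.
  rewrite big_sumType /= {1}[z]row_sum_delta -big_split; apply: eq_bigr => j _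
    /=.
  rewrite scalerA -scalerDl; congr (_ *: _).
  by rewrite /of_real; case: (z 0 j) => x y; simpc.
(* The minus sign makes the real part of [phi j * (x + i y)] equal to
   [b (inl j) * x + b (inr j) * y]. *)
pose phi j : cplx R := (b (inl j) -i* b (inr j))%C.
have phiE (z : 'rV[cplx R]_n) : complex.Re (\sum_i phi i * z 0 i : R[i]) =
  \sum_i co z i * b i.
  have ReD (x y : R[i]) : complex.Re (x + y) = complex.Re x + complex.Re y.
    by case: x y => [? ?] [? ?].
  have Re0 : complex.Re (0 : R[i]) = 0 by [].
  rewrite (big_morph (@complex.Re R) ReD Re0) big_sumType /= -big_split; apply:
    eq_bigr => j _ /=.
  rewrite /phi; case: (z 0 j) => x y /=; ring.
exists phi; split.
  move=> z Qz.
  set w := \sum_i _.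
  have [->|w0] := eqVneq w 0; first by rewrite /cmod normr0.
  have nw : `|w| != 0 by rewrite normr_eq0.
  (* Rotating [z] by [om] keeps it in [Q] and makes the value of the form equal to its modulus. *)
  pose om := `|w| / w.
  have om1 : `|om| = 1 by rewrite normrM normfV normr_id divff.
  have Eom : E 1 (om *: z) by rewrite /E invr1 of_real1 scale1r; apply: Qc;
    rewrite ?om1.
  have := hb 0 (co (om *: z)) 1 ltr01.
  rewrite -coE of_real0 scale0r add0r => /(_ Eom).
  rewrite add0r -phiE (_ : \sum_i _ = `|w|) //.
  rewrite -[RHS](divfK w0) mulr_sumr; apply: eq_bigr => i _.
  by rewrite mxE mulrCA.
have Rew : complex.Re (\sum_i phi i * p 0 i : R[i]) <= cmod (\sum_i phi i * p 0
  i).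
  have := normc_ge_Re (\sum_i phi i * p 0 i); rewrite (cmodE (\sum_i phi i * p
    0 i)) of_real_le.
  exact/le_trans/ler_norm.
apply: le_trans Rew; rewrite phiE; apply/ler_addgt0Pr => e e0.
(* The vector [p - p = 0] lies in every multiple of [Q], so domination gives that 1 minus the value
   at [p] is at most any [e > 0]. *)
have := hb 1 (fun i => - co p i) e e0.
have -> : of_real 1 *: p + \sum_i of_real (- co p i) *: v i = 0.
  rewrite of_real1 scale1r {1}[p]coE -big_split big1 // => i _ /=.
  by rewrite of_realN scaleNr subrr.
rewrite {1}/E scaler0 => /(_ Q0).
under eq_bigr do rewrite mulNr.
by rewrite sumrN; lra.
Qed.
End supporting_functional.

(** * The Moebius function of a linear form *)

(** The power expands into products over all maps from ['I_k] to ['I_n]. Grouping the maps by the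
    sizes of their fibres gives the monomials, with the multinomial coefficients left as sums over
    maps. *)
Lemma homogeneous_linear_form (R : realType) (n : nat) (H : normedModType (cplx
  R))
    (phi : 'I_n -> cplx R) (k : nat) (T : bop H) :
  homogeneous_poly k (fun z : 'rV[cplx R]_n => (\sum_i phi i * z 0 i) ^+ k *:
    T).
Proof.
pose cnt (g : {ffun 'I_k -> 'I_n}) : {ffun 'I_n -> 'I_k.+1} :=
  [ffun j => inord #|[pred i | g i == j]|].
have cntE g j : cnt g j = #|[pred i | g i == j]| :> nat.
  by rewrite ffunE inordK // ltnS (leq_trans (max_card _)) // card_ord.
have cnt_sum g : (\sum_j cnt g j == k)%N.
  apply/eqP; transitivity (\sum_(i < k) 1)%N; last by rewrite sum1_card
    card_ord.
  rewrite (partition_big g xpredT) //; apply: eq_bigr => j _.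
  by rewrite cntE -sum1_card.
exists (fun al => \sum_(g : {ffun 'I_k -> 'I_n} | cnt g == al) (\prod_i phi (g
  i)) *: T).
move=> z.
have -> : (\sum_i phi i * z 0 i) ^+ k =
    \sum_(g : {ffun 'I_k -> 'I_n}) \prod_i (phi (g i) * z 0 (g i)).
  rewrite -[k in LHS]card_ord -prodr_const.
  exact: (bigA_distr_bigA (fun (_ : 'I_k) j => phi j * z 0 j)).
rewrite (partition_big cnt (fun al => \sum_j al j == k)%N) //= scaler_suml.
apply: eq_bigr => al _; rewrite scaler_suml scaler_sumr.
apply: eq_bigr => g /eqP <-; rewrite scalerA big_split /= mulrC; congr (_ * _
  *: _).
rewrite (partition_big g xpredT) //=; apply: eq_bigr => j _.
by rewrite (eq_bigr (fun=> z 0 j)) => [|i /eqP -> //]; rewrite prodr_const cntE.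
Qed.

Section extremal.
Variables (R : realType) (n : nat) (H : normedModType (cplx R)).
Variables (Q : set 'rV[cplx R]_n) (phi : 'I_n -> cplx R) (a : R).
Hypothesis a01 : 0 < a < 1.
Let Phi (z : 'rV[cplx R]_n) : cplx R := \sum_i phi i * z 0 i.
Hypothesis Phi_lt1 : forall z, Q z -> cmod (Phi z) < 1.

(* The Taylor expansion of [(a - w) / (1 - a w)] at [w = Phi z]. *)
Definition moebius_coef (k : nat) : R :=
  if k is j.+1 then - ((1 - a ^+ 2) * a ^+ j) else a.

Definition moebius_poly k (z : 'rV[cplx R]_n) : bop H :=
  Phi z ^+ k *: (of_real (moebius_coef k) *: idop H).

Definition moebius (z : 'rV[cplx R]_n) : bop H :=
  ((of_real a - Phi z) / (1 - of_real a * Phi z)) *: idop H.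

Let a0 : 0 < a. Proof. by case/andP: a01. Qed.
Let a1 : a < 1. Proof. by case/andP: a01. Qed.

Lemma moebius_denom_neq0 (w : cplx R) : cmod w < 1 -> 1 - of_real a * w != 0.
Proof.
move=> w1; rewrite subr_eq0; apply/eqP => /(congr1 (@cmod R)).
rewrite cmodM cmod_real ?ltW // -of_real1 cmod_real // => aw.
have := cmod_ge0 w; have := a0; have := a1; nra.
Qed.

Lemma cmod_moebius_lt1 (w : cplx R) : cmod w < 1 ->
  cmod ((of_real a - w) / (1 - of_real a * w)) < 1.
Proof.
move=> w1; have d0 := moebius_denom_neq0 w1.
have := cmodM ((of_real a - w) / (1 - of_real a * w)) (1 - of_real a * w).
rewrite divfK //; set u := cmod (_ / _) => uE.
have u0 : 0 <= u by exact: cmod_ge0.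
have d1 : 0 <= cmod (1 - of_real a * w) by exact: cmod_ge0.
(* The difference of the two squares is [(1 - a ^+ 2) * (1 - cmod w ^+ 2)]. *)
have lt : cmod (of_real a - w) ^+ 2 < cmod (1 - of_real a * w) ^+ 2.
  have w0 := cmod_ge0 w.
  have : 0 < (1 - a ^+ 2) * (1 - cmod w ^+ 2).
    by rewrite mulr_gt0 // subr_gt0 expr_lt1 // ltW.
  rewrite !cmod_sqr; move: (w) => [x y] /=; nra.
rewrite ltNge; apply/negP => u1; move: lt.
by rewrite uE exprMn ltNge ler_peMl ?sqr_ge0 ?exprn_ege1.
Qed.

Lemma cmod_moebius_coef_le1 k : cmod (of_real (moebius_coef k)) <= 1.
Proof.
have := a0; have := a1 => ? ?.
case: k => [|j]; first by rewrite /= cmod_real ltW.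
have aj : 0 <= a ^+ j <= 1 by rewrite exprn_ge0 ?exprn_ile1 // ltW.
rewrite /= of_realN cmodN cmod_real ?mulr_ge0 //; nra.
Qed.

(** Geometric summation with an explicit remainder, from which convergence follows; the induction
    runs after clearing the denominator. *)
Lemma moebius_series (w : cplx R) (N : nat) : cmod w < 1 ->
  \sum_(0 <= k < N.+1) w ^+ k * of_real (moebius_coef k) =
  (of_real a - w) / (1 - of_real a * w) +
  of_real (1 - a ^+ 2) * w / (1 - of_real a * w) * (of_real a * w) ^+ N.
Proof.
move=> w1; have d0 := moebius_denom_neq0 w1.
apply: (mulIf d0); rewrite mulrDl divfK // [X in _ = _ + X]mulrAC divfK //.
have -> : of_real (1 - a ^+ 2) = 1 - of_real a ^+ 2 :> cplx R.
  by rewrite of_realD of_realN of_realM.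
elim: N => [|N IH].
  by rewrite big_nat1 /= !expr0; ring.
rewrite big_nat_recr //= mulrDl IH of_realN of_realM.
have -> : of_real (1 - a ^+ 2) = 1 - of_real a ^+ 2 :> cplx R.
  by rewrite of_realD of_realN of_realM.
have -> : of_real (a ^+ N) = of_real a ^+ N :> cplx R.
  exact: (rmorphXn (real_complex R)).
by rewrite !exprMn [w ^+ N.+1]exprS [of_real a ^+ N.+1]exprS; ring.
Qed.

Lemma cvg_moebius z : Q z -> series (moebius_poly ^~ z) @ \oo --> moebius z.
Proof.
move=> Qz; have w1 := Phi_lt1 Qz; set w := Phi z in w1.
pose K := cmod (of_real (1 - a ^+ 2) * w / (1 - of_real a * w)).
apply/cvgrPdist_le => e e0.
have eE : e = of_real (cmod e) by rewrite -cmodE ger0_norm // ltW.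
have c0 : 0 < cmod e by rewrite -of_real_lt -eE.
have : geometric K a @ \oo --> 0.
  by apply: cvg_geometric; rewrite ger0_norm // ltW.
move=> /cvgrPdist_le /(_ _ c0)[N _ NP]; exists N.+1 => // -[//|m] /= Nm.
have -> : moebius z - series (moebius_poly ^~ z) m.+1 =
    - (of_real (1 - a ^+ 2) * w / (1 - of_real a * w) * (of_real a * w) ^+ m)
      *: idop H.
  rewrite /series /= /moebius_poly.
  under eq_bigr do rewrite scalerA.
  rewrite -scaler_suml moebius_series // -scalerBl -/w; congr (_ *: _).
  by rewrite opprD addrA subrr add0r.
rewrite bop_normE eE of_real_le opnormZE cmodN cmodM cmodX -/K.
rewrite (le_trans _ (NP m Nm)) // sub0r normrN /= ger0_norm; last first.
  by rewrite mulr_ge0 ?cmod_ge0 ?exprn_ge0 // ltW.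
rewrite -[leRHS]mulr1 ler_pM ?opnorm_ge0 ?opnorm_idop_le //.
  by rewrite mulr_ge0 ?exprn_ge0 ?cmod_ge0.
rewrite ler_wpM2l ?cmod_ge0 // lerXn2r ?nnegrE ?cmod_ge0 // ?(ltW a0) //.
by rewrite cmodM cmod_real ?(ltW a0) // ler_piMr ?(ltW a0) // ltW.
Qed.

Lemma cvg_area_moebius z : Q z -> cvgn (area_series moebius_poly z).
Proof.
move=> Qz; have w1 := Phi_lt1 Qz; have w0 := cmod_ge0 (Phi z).
have q01 : 0 <= cmod (Phi z) ^+ 2 < 1 by rewrite sqr_ge0 expr_lt1.
apply: nondecreasing_is_cvgn.
  by apply: nondecreasing_series => k _; rewrite mulr_ge0 ?sqr_ge0.
exists (cmod (Phi z) ^+ 2 / (1 - cmod (Phi z) ^+ 2) ^+ 2) => _ [N _ <-].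
apply: le_trans (sum_natmul_expr_le N q01); apply: ler_sum => k _.
rewrite ler_wpM2l // -exprM mulnC exprM lerXn2r ?nnegrE ?opnorm_ge0 ?exprn_ge0
  //.
rewrite !opnormZE cmodX ler_piMr ?exprn_ge0 //.
by rewrite mulr_ile1 ?cmod_ge0 ?opnorm_ge0 ?cmod_moebius_coef_le1
  ?opnorm_idop_le.
Qed.

Lemma contractive_moebius : contractive_expansion Q moebius_poly moebius
  (of_real a).
Proof.
split.
- by move=> k; exact: homogeneous_linear_form.
- exact: cvg_moebius.
- exact: cvg_area_moebius.
- move=> z Qz; have d1 := cmod_moebius_lt1 (Phi_lt1 Qz).
  rewrite bop_normE -of_real1 of_real_lt opnormZE.
  by rewrite (le_lt_trans _ d1) // ler_piMr ?cmod_ge0 ?opnorm_idop_le.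
- have Phi0 : Phi 0 = 0 by rewrite /Phi big1 // => i _; rewrite mxE mulr0.
  rewrite /moebius Phi0 subr0 mulr0 subr0 divr1; split => //.
  by rewrite norm_lt1 cmod_real // ltW.
Qed.

Lemma sum_opnorm_moebius z (N : nat) : (exists x : H, x <> 0) -> Q z ->
  (1 - a * cmod (Phi z)) * \sum_(0 <= k < N.+1) opnorm (moebius_poly k z) =
  a * (1 - a * cmod (Phi z)) + (1 - a ^+ 2) * cmod (Phi z) * (1 - (a * cmod
    (Phi z)) ^+ N).
Proof.
move=> H0 Qz; set s := cmod (Phi z).
have opE k : opnorm (moebius_poly k z) = s ^+ k * cmod (of_real (moebius_coef
  k)).
  by rewrite !opnormZE cmodX opnorm_idop // mulr1.
elim: N => [|N IH].
  by rewrite big_nat1 opE !expr0 /= cmod_real ?(ltW a0) //; ring.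
rewrite big_nat_recr //= mulrDr IH opE /= of_realN cmodN cmod_real; last first.
  by rewrite mulr_ge0 ?exprn_ge0 ?(ltW a0) // subr_ge0 exprn_ile1 ?(ltW a0) //
    ltW.
by rewrite !exprMn !exprS; ring.
Qed.

(** As [G] is nonnegative, the norm series alone has to exceed 1. With [s = cmod (Phi z)] its sum is
    [a + (1 - a ^+ 2) * s / (1 - a * s)], which is larger than 1 exactly when
    [s * (1 + 2 * a) > 1]. *)
Lemma bohr_sum_moebius_gt1 (G : {poly R}) z : (exists x : H, x <> 0) -> Q z ->
  (forall x, 0 <= x -> 0 <= G.[x]) -> 1 < cmod (Phi z) * (1 + 2 * a) ->
  ~ (bohr_sum G moebius_poly z <= 1)%E.
Proof.
move=> H0 Qz G0 sa; rewrite /bohr_sum; set S := limn (area_series _ _) => le1.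
have S0 : 0 <= S.
  apply: limr_ge; [exact: cvg_area_moebius | apply: nearW => N].
  by rewrite sumr_ge0 // => k _; rewrite mulr_ge0 // sqr_ge0.
have s1 := Phi_lt1 Qz; have s0 := cmod_ge0 (Phi z).
have partial N : \sum_(0 <= k < N) opnorm (moebius_poly k z) <= 1.
  rewrite -lee_fin -sumEFin; apply: le_trans le1.
  apply: (@le_trans _ _ (\sum_(0 <= k <oo) (opnorm (moebius_poly k z))%:E)%E).
    by apply: nneseries_lim_ge => k _ _; rewrite lee_fin opnorm_ge0.
  by rewrite leeDl // lee_fin G0.
have := sum_opnorm_moebius _ H0 Qz.
set s := cmod (Phi z) in sa s1 s0 * => sumE.
have as1 : 0 < 1 - a * s by have := a0; have := a1; nra.
(* Cancelling [1 - a] in the bound on a partial sum leaves a remainder that tends to 0, against the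
   positive left-hand side. *)
have bound N : s * (1 + 2 * a) - 1 <= 2 * a ^+ N.
  have := sumE N; have := partial N.+1; set p := \sum_(_ <= _ < _) _ => p1 pE.
  have aN : (a * s) ^+ N <= a ^+ N.
    by rewrite lerXn2r ?nnegrE ?mulr_ge0 ?(ltW a0) // ler_piMr ?(ltW a0) // ltW.
  have h : (1 - a) * ((1 + a) * s * (1 - (a * s) ^+ N)) <= (1 - a) * (1 - a *
    s).
    have : (1 - a * s) * p <= (1 - a * s) * 1 by rewrite ler_wpM2l // ltW.
    by rewrite pE; lra.
  rewrite ler_pM2l ?subr_gt0 // in h.
  have h2 : (1 + a) * s * (a * s) ^+ N <= 2 * a ^+ N.
    rewrite ler_pM ?mulr_ge0 ?exprn_ge0 ?mulr_ge0 ?addr_ge0 ?(ltW a0) //.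
    by have := a0; have := a1; nra.
  lra.
have : geometric 2 a @ \oo --> 0.
  by apply: cvg_geometric; rewrite ger0_norm // ltW.
have d0 : 0 < (s * (1 + 2 * a) - 1) / 2 by lra.
move=> /cvgrPdist_le /(_ _ d0)[N _ /(_ N (leqnn N))] /=.
rewrite sub0r normrN ger0_norm ?mulr_ge0 ?exprn_ge0 ?(ltW a0) //.
have := bound N; lra.
Qed.
End extremal.

(** * The choice of the extremal point and function *)

(** A substitute for a boundary point: shrink an outside point by powers of [lam] and stop just
    before it first enters [Q]. *)
Lemma boundary_ray (R : realType) (n : nat) (Q : set 'rV[cplx R]_n) (lam : R) :
  complete_circular_domain Q -> Q <> setT -> 0 < lam < 1 ->
  exists2 p, ~ Q p & Q (of_real lam *: p).
Proof.
move=> Qcirc QT /andP[l0 l1].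
have [q nQq] : exists q, ~ Q q.
  by apply: contrapT => h; apply: QT; rewrite -subTset => x _; apply: contrapT
    => nx; apply: h; exists x.
have [d d0 dQ] := absorbing Qcirc q.
have ex : exists k, `[< Q (of_real (lam ^+ k) *: q) >].
  have : geometric 1 lam @ \oo --> 0 by apply: cvg_geometric; rewrite ger0_norm
    // ltW.
  move=> /cvgrPdist_le /(_ d d0)[N _ /(_ N (leqnn N))] /=.
  rewrite sub0r normrN mul1r ger0_norm ?exprn_ge0 ?(ltW l0) // => Nd.
  by exists N; apply/asboolP/dQ; rewrite Nd exprn_ge0 // ltW.
case: (ex_minnP ex) => -[|k] /asboolP Qk kmin.
  by case: nQq; rewrite expr0 of_real1 scale1r in Qk.
exists (of_real (lam ^+ k) *: q).
  by move=> /asboolP/kmin; rewrite ltnn.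
by rewrite scalerA -of_realM -exprS.
Qed.

Theorem theorem2p5 (R : realType)
  (H : completeNormedModType (cplx R)) (dot : {dot H for Num.conj})
  (H_hilbert : forall x : H, `|x| ^+ 2 = dot x x)
  (n : nat) (Q : set 'rV[cplx R]_n) (Q_circular : complete_circular_domain Q)
  (l : nat) (l_gt0 : (0 < l)%N) (c : nat -> R)
  (c_ge0 : forall m, (1 <= m <= l)%N -> 0 <= c m)
  (c_le1 : \sum_(1 <= m < l.+1)
     8 * (2 * m - 1)%N%:R * c m * (3 / 8) ^+ (2 * m) <= 1) :
  let G : {poly R} := \sum_(1 <= m < l.+1) c m *: 'X^m in
  (forall (P : nat -> 'rV[cplx R]_n -> bop H) (f : 'rV[cplx R]_n -> bop H)
      (a0 : cplx R),
    contractive_expansion Q P f a0 ->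
    forall z, homothety (1 / 3) Q z -> (bohr_sum G P z <= 1)%E)
  /\
  (convex_set Q -> Q <> setT -> (exists x : H, x <> 0) ->
    forall rho : R, 1 / 3 < rho -> rho < 1 ->
    exists (P : nat -> 'rV[cplx R]_n -> bop H) (f : 'rV[cplx R]_n -> bop H)
        (a0 : cplx R),
      contractive_expansion Q P f a0 /\
      exists z, homothety rho Q z /\ ~ (bohr_sum G P z <= 1)%E).
Proof.
move=> G; split; first exact: (bohr_sum_le1 H_hilbert Q_circular c_ge0 c_le1).
move=> Q_convex QT H0 rho rho13 rho1.
have [_ _ _ Qc] := Q_circular.
(* The loss is [lam] once for [lam p] instead of [p], and once for
   [lam phi] instead of [phi]: [lam] is chosen so that [rho lam^2 > 1 / 3]. *)
pose lam : R := (1 + 1 / (3 * rho)) / 2.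
have rho0 : 0 < rho by lra.
have r3 : 0 < 1 / (3 * rho) < 1.
  by rewrite divr_gt0 ?mulr_gt0 //= ltr_pdivrMr ?mulr_gt0 // mul1r; lra.
have re : rho * (1 / (3 * rho)) = 1 / 3 by field; rewrite gt_eqF.
have lam01 : 0 < lam < 1 by rewrite /lam; apply/andP; split; lra.
(* With [t = 1 / (3 * rho) < 1], this is [((1 + t) / 2) ^+ 2 > t]. *)
have lam13 : 1 / 3 < rho * lam ^+ 2 by rewrite /lam; nra.
have [l0 l1] := andP lam01.
have [p nQp Qp] := boundary_ray Q_circular QT lam01.
have [phi [phiQ phip]] := supporting_functional Q_circular Q_convex nQp.
(* The form [phi] is only bounded by 1 on [Q]; the factor [lam] makes the bound strict. *)
pose psi i := of_real lam * phi i.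
have psiE z : cmod (\sum_i psi i * z 0 i) = lam * cmod (\sum_i phi i * z 0 i).
  rewrite -[in RHS](cmod_real (ltW l0)) -cmodM mulr_sumr; congr cmod.
  by apply: eq_bigr => i _; rewrite mulrA.
have psi_lt1 z : Q z -> cmod (\sum_i psi i * z 0 i) < 1.
  by move=> /phiQ z1; rewrite psiE; nra.
pose z := of_real rho *: (of_real lam *: p).
have Qz : Q z.
  apply: Qc => //; rewrite cmodE cmod_real ?(ltW rho0) //.
  by rewrite -of_real1 of_real_le ltW.
have s3 : 1 / 3 < cmod (\sum_i psi i * z 0 i).
  apply: (lt_le_trans lam13); rewrite psiE.
  have -> : \sum_i phi i * z 0 i = of_real (rho * lam) * \sum_i phi i * p 0 i.
    rewrite mulr_sumr; apply: eq_bigr => i _.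
    by rewrite /z scalerA -of_realM mxE mulrCA.
  rewrite cmodM (cmod_real (mulr_ge0 (ltW rho0) (ltW l0))).
  have -> : lam * (rho * lam * cmod (\sum_i phi i * p 0 i)) =
      rho * lam ^+ 2 * cmod (\sum_i phi i * p 0 i) by ring.
  by rewrite ler_peMr // mulr_ge0 ?sqr_ge0 ?(ltW rho0).
set s := cmod _ in s3.
have s1 : s < 1 := psi_lt1 z Qz.
have s0 : 0 < s by lra.
(* The condition [s * (1 + 2 * a) > 1] means [a > (s^-1 - 1) / 2], a threshold in [(0, 1)] because
   [1 / 3 < s < 1]; [a] is the midpoint between it and 1. *)
pose a : R := (1 + (s^-1 - 1) / 2) / 2.
have si : s * s^-1 = 1 by rewrite mulfV // gt_eqF.
have si3 : s^-1 < 3 by rewrite -(ltr_pM2l s0) si; lra.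
have si1 : 1 < s^-1 by rewrite -(ltr_pM2l s0) si mulr1.
have a01 : 0 < a < 1 by rewrite /a; apply/andP; split; lra.
have sa : 1 < s * (1 + 2 * a) by rewrite /a; nra.
exists (moebius_poly H psi a), (moebius H psi a), (of_real a); split.
  exact: contractive_moebius.
exists z; split; first by exists (of_real lam *: p).
apply: (bohr_sum_moebius_gt1 a01 psi_lt1) => // x x0.
rewrite /G horner_sum big_nat_cond sumr_ge0 // => m /andP[ml _].
by rewrite hornerZ hornerXn mulr_ge0 ?exprn_ge0 ?c_ge0.
Qed.
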